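(* For every real number $a \geq 2$ and every $x \in (0,\pi)$ the following inequality holds: $$\left(\frac{\sin x}{x}\right)^{a} \;\leq\; \cos^{2}\frac{x}{2}.$$ *)

(* Defs.v *)
From Stdlib Require Export Reals.

(* Main.v *)
Require Import Defs.
From Stdlib Require Import Reals.
From Stdlib Require Import Lra.
Open Scope R_scope.

(** Since [sin x / x = cos (x/2) * (sin (x/2) / (x/2))] and [sin t < t] for
    [t > 0], the base [sin x / x] lies strictly between [0] and [cos (x/2) <= 1].
    A power of a base below [1] decreases in the exponent, so [a = 2] is the
    worst case. *)

Lemma sinc_pos (x : R) : 0 < x < PI -> 0 < sin x / x.
Proof.
intros [x_gt0 x_ltPI].
apply Rdiv_lt_0_compat; [apply sin_gt_0|]; assumption.
Qed.

Lemma sinc_le_cos_half (x : R) : 0 < x < PI -> sin x / x <= cos (x / 2).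
Proof.
intros [x_gt0 x_ltPI].
apply Rmult_le_reg_r with x; [assumption|].
replace (sin x / x * x) with (sin x) by (field; lra).
replace (sin x) with (2 * sin (x / 2) * cos (x / 2))
  by (rewrite <- sin_2a; f_equal; field).
assert (cos_pos : 0 < cos (x / 2)) by (apply cos_gt_0; lra).
assert (sin_lt : sin (x / 2) < x / 2) by (apply sin_lt_x; lra).
(* What remains is [2 * sin (x / 2) * cos (x / 2) <= cos (x / 2) * x], which is [sin_lt] multiplied
   by the positive [2 * cos (x / 2)]. *)
nra.
Qed.

(** [Rpower b q] is [exp (q * ln b)], and multiplying by [ln b <= 0] reverses the order of the
    exponents. *)
Lemma Rpower_le_contravar (b p q : R) :
  0 < b <= 1 -> p <= q -> Rpower b q <= Rpower b p.
Proof.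
intros [b_gt0 b_le1] le_pq.
assert (ln_le0 : ln b <= 0).
{ rewrite <- ln_1.
  destruct b_le1 as [b_lt1 | ->]; [left; apply ln_increasing; assumption | lra]. }
unfold Rpower.
destruct (Rle_lt_or_eq_dec (q * ln b) (p * ln b)) as [lt_exp | ->]; [nra | | lra].
left; apply exp_increasing; assumption.
Qed.

Theorem theorem5 (a x : R) (ha : 2 <= a) (hx : 0 < x < PI) :
  Rpower (sin x / x) a <= (cos (x / 2)) ^ 2.
Proof.
assert (base_pos := sinc_pos x hx).
assert (base_le := sinc_le_cos_half x hx).
assert (cos_le1 := COS_bound (x / 2)).
(* The exponent 2 is written [INR 2] so that [Rpower_pow] can turn the real power into a natural
   one. *)
apply Rle_trans with (Rpower (sin x / x) (INR 2)).
- apply Rpower_le_contravar; simpl; lra.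
- rewrite Rpower_pow by assumption.
  apply pow_incr; lra.
Qed.
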